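(* Let $H_0,H_1$ be Hilbert spaces, let $A_0$ and $A$ be densely defined closed linear operators from $H_0$ to $H_1$ with $A_0\subseteq A$, put $B_0=-A^{\ast}$, and let $A^{\#}\subseteq A$ be the restriction of $A$ to $\operatorname{dom}(A^{\#})=\{x\in\operatorname{dom}(A) : Ax\in\overline{\operatorname{ran}}(A_0)\}$. Let $\mathcal{A}\colon\operatorname{dom}(\mathcal{A})\subseteq X\to Y$ be a densely defined closed linear operator between two Hilbert spaces $X,Y$. Assume that $\operatorname{ran}(\mathcal{A})$ is closed and that there exist isometries $\iota_X\colon H_0\to X$ and $\iota_Y\colon H_1\to Y$ such that $$\iota_Y A_0\subseteq\mathcal{A}\iota_X\quad\text{and}\quad \iota_X B_0\subseteq-\mathcal{A}^{\ast}\iota_Y.$$ Then $A^{\#}$ has closed range. Moreover, if the embedding $D_{\mathcal{A}_{\mathrm{red}}}\hookrightarrow X$ is compact, then the embedding $D_{(A^{\#})_{\mathrm{red}}}\hookrightarrow H_0$ is compact.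
   Context: For (unbounded) linear operators, $S\subseteq T$ means that $T$ extends $S$; $\overline{\operatorname{ran}}(T)$ is the closure of the range of $T$; isometries are linear (not necessarily surjective). Products of operators have their natural domains, e.g. $\operatorname{dom}(\mathcal{A}\iota_X)=\{x\in H_0 : \iota_X x\in\operatorname{dom}(\mathcal{A})\}$ and $\operatorname{dom}(\iota_Y A_0)=\operatorname{dom}(A_0)$. For a closed densely defined linear operator $T\colon\operatorname{dom}(T)\subseteq K_0\to K_1$ between Hilbert spaces, the reduced operator is $T_{\mathrm{red}}\colon\operatorname{dom}(T)\cap\ker(T)^\perp\subseteq\ker(T)^\perp\to\overline{\operatorname{ran}}(T)$, $x\mapsto Tx$, and $D_{T_{\mathrm{red}}}=\operatorname{dom}(T)\cap\ker(T)^\perp$ equipped with the graph norm of $T_{\mathrm{red}}$. *)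

(* Defs.v *)
From HB Require Import structures.
From mathcomp Require Import all_boot all_order all_algebra.
From mathcomp Require Import all_classical all_reals all_analysis.
From mathcomp Require Import complex.

Set Implicit Arguments.
Unset Strict Implicit.
Unset Printing Implicit Defensive.

Import Order.TTheory GRing.Theory Num.Theory.
Import numFieldNormedType.Exports.

Local Open Scope classical_set_scope.
Local Open Scope ring_scope.

(* The scalars of a Hilbert space are the reals, with the identity as
   conjugation, or the complex numbers, with complex conjugation. *)
Variant real_or_complex : forall K : numFieldType, (K -> K) -> Prop :=
  | RealScalars (R : realType) : @real_or_complex R idfun
  | ComplexScalars (R : realType) : @real_or_complex R[i] (@conjc R).

(* The inner product is linear in its first argument and theta-semilinear in
   the second one.  Over R[i] norms are elements of R[i] (with zero imaginary
   part). *)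
HB.mixin Record CompleteNormedModule_isHilbert (K : numFieldType)
    (theta : K -> K) H of CompleteNormedModule K H := {
  inner : {dot H for theta} ;
  inner_norm : forall x : H, inner x x = `|x| ^+ 2
}.

#[short(type="hilbertType")]
HB.structure Definition Hilbert (K : numFieldType) (theta : K -> K) :=
  {H of CompleteNormedModule K H & CompleteNormedModule_isHilbert K theta H}.

Section orthogonality.
Context {K : numFieldType} {theta : K -> K} {H : hilbertType theta}.

Definition orthocompl (S : set H) : set H :=
  [set x | forall y, S y -> inner x y = 0].

End orthogonality.

(* A possibly unbounded, partially defined map: the values of op_fun outside
   op_dom are irrelevant. *)
Record operator (U V : Type) := Operator {
  op_dom : set U ;
  op_fun :> U -> V
}.

Section operators.
Context {K : numFieldType}.
Implicit Types U V W : completeNormedModType K.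

Definition op_linear U V (T : operator U V) : Prop :=
  op_dom T 0 /\
  forall (a : K) (x y : U), op_dom T x -> op_dom T y ->
    op_dom T (a *: x + y) /\ T (a *: x + y) = a *: T x + T y.

Definition op_graph U V (T : operator U V) : set (U * V) :=
  [set p | op_dom T p.1 /\ T p.1 = p.2].

Definition op_ran U V (T : operator U V) : set V := T @` op_dom T.

Definition op_ker U V (T : operator U V) : set U :=
  [set x | op_dom T x /\ T x = 0].

Definition densely_defined_closed_linear U V (T : operator U V) : Prop :=
  [/\ op_linear T, dense (op_dom T) & closed (op_graph T)].

Definition op_extends U V (S T : operator U V) : Prop :=
  op_dom S `<=` op_dom T /\ forall x, op_dom S x -> S x = T x.

Definition op_total U V (f : U -> V) : operator U V := Operator setT f.

Definition op_comp U V W (S : operator V W) (T : operator U V) :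
    operator U W :=
  Operator [set x | op_dom T x /\ op_dom S (T x)] (S \o T).

Definition op_opp U V (T : operator U V) : operator U V :=
  Operator (op_dom T) (fun x => - T x).

Definition op_restrict U V (T : operator U V) (D : set U) : operator U V :=
  Operator (op_dom T `&` D) T.

Definition sharp U V (A0 A : operator U V) : operator U V :=
  op_restrict A [set x | closure (op_ran A0) (A x)].

Definition linear_isometry U V (f : U -> V) : Prop :=
  linear f /\ forall x, `|f x| = `|x|.

End operators.

Notation "S `<=op` T" := (op_extends S T) (at level 70, no associativity).
Notation "S \oop T" := (op_comp S T) (at level 50, left associativity).

Section adjoint.
Context {K : numFieldType} {theta : K -> K} {U V : hilbertType theta}.

Definition adjoint_pair (T : operator U V) (y : V) (z : U) : Prop :=
  forall x, op_dom T x -> inner (T x) y = inner x z.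

(* For densely defined T the z chosen by xget is the only candidate. *)
Definition adjoint (T : operator U V) : operator V U :=
  Operator [set y | exists z, adjoint_pair T y z]
           (fun y => xget 0 [set z | adjoint_pair T y z]).

(* The reduced operator, seen as an operator between the ambient spaces. *)
Definition reduced (T : operator U V) : operator U V :=
  op_restrict T (orthocompl (op_ker T)).

(* Bounded in the domain of T for the graph norm, whose square is
   |x|^2 + |T x|^2. *)
Definition graph_bounded (T : operator U V) (S : set U) : Prop :=
  S `<=` op_dom T /\
  exists2 r : K, 0 <= r & forall x, S x -> `|x| ^+ 2 + `|T x| ^+ 2 <= r ^+ 2.

(* The embedding into U of the domain of T with its graph norm is compact:
   bounded sets are mapped to relatively compact sets. *)
Definition compact_dom_embedding (T : operator U V) : Prop :=
  forall S : set U, graph_bounded T S -> precompact S.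

End adjoint.

(* Main.v *)
(* The isometries turn the adjoint inclusion into a lifting principle: if [u] is
   in the domain of [calA] and [calA u = iY y], then the inner products of
   [iX^* u] with the range of [A^*] agree with those of [y] with the domain of
   [A^*], so [A (iX^* u) = y] because [A^** = A].  Every [y] in the closure of
   [ran A0] has such a [u], since [ran calA] is closed; this gives the closed
   range.  For compactness, take [u] orthogonal to [ker calA]: compactness itself
   bounds it by [calA u], so neither the open mapping theorem nor Baire category
   enters.  The element [x] of the reduced domain with [A x = y] is the image of
   [u] under the adjoint of [iX] restricted to the orthogonal complement of the
   kernel, a nonexpansive map.  Hence a bounded set is contained in the continuous
   image of a relatively compact one. *)
Require Import Defs.
From HB Require Import structures.
From mathcomp Require Import all_boot all_order all_algebra.
From mathcomp Require Import all_classical all_reals all_analysis.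
From mathcomp Require Import complex ring.

Set Implicit Arguments.
Unset Strict Implicit.
Unset Printing Implicit Defensive.

Import Order.TTheory GRing.Theory Num.Theory.
Import numFieldNormedType.Exports.

Local Open Scope classical_set_scope.
Local Open Scope ring_scope.

(** * Conjugation and infima over the two scalar fields *)

Section scalars.
Context {K : numFieldType} {theta : K -> K} (HK : real_or_complex theta).

Lemma conjK : involutive theta.
Proof. by case: HK => // R; exact: conjcK. Qed.

Lemma conjD (x y : K) : theta (x + y) = theta x + theta y.
Proof. by case: HK x y => // R x y; rewrite rmorphD. Qed.

Lemma conjN (x : K) : theta (- x) = - theta x.
Proof. by case: HK x => // R x; rewrite rmorphN. Qed.

Lemma conjM (x y : K) : theta (x * y) = theta x * theta y.
Proof. by case: HK x y => // R x y; rewrite rmorphM. Qed.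

Lemma conj_ge0_id (s : K) : 0 <= s -> theta s = s.
Proof.
case: HK s => // R s s0.
by rewrite -(RRe_real (ger0_real s0)) conjc_real.
Qed.

Lemma normCK_conj (x : K) : x * theta x = `|x| ^+ 2.
Proof.
case: HK x => R x; last by rewrite sqr_normc.
by rewrite -normrX ger0_norm ?sqr_ge0// expr2.
Qed.

Lemma norm_conj (x : K) : `|theta x| = `|x|.
Proof.
apply: (pexpIrn (n := 2)); rewrite ?nnegrE//.
by rewrite -!normCK_conj conjK mulrC.
Qed.

(** The order of [R[i]] is only partial, but its nonnegative elements are real: the infimum is taken
    over real parts and carried back. *)
Lemma nonneg_inf (P : set K) : P !=set0 -> (forall x, P x -> 0 <= x) ->
  exists2 d : K, (forall x, P x -> d <= x) &
    forall e, 0 < e -> exists2 x, P x & x < d + e.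
Proof.
case: HK P => R P P0 Pge0.
  have infP : has_inf P by split=> //; exists 0 => x /Pge0.
  exists (inf P) => [x Px|e e0]; first by apply: ge_inf => //; case: infP.
  by have [x Px xlt] := inf_adherent e0 infP; exists x.
have PE x : P x -> x = (complex.Re x)%:C%C.
  by move=> /Pge0 x0; rewrite RRe_real// ger0_real.
pose Q := @complex.Re R @` P.
have infQ : has_inf Q.
  split; first by case: P0 => x Px; exists (complex.Re x); exists x.
  by exists 0 => _ [x Px <-]; move: (Pge0 x Px); rewrite {1}(PE x Px) lecR.
exists (inf Q)%:C%C => [x Px|e e0].
  by rewrite (PE x Px) lecR; apply: ge_inf; [case: infQ|exists x].
have eE : e = (complex.Re e)%:C%C by rewrite RRe_real// gtr0_real.
have : 0 < complex.Re e by rewrite -ltcR -eE.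
move=> /inf_adherent/(_ infQ)[_ [x Px <-]] xlt; exists x => //.
by rewrite (PE x Px) eE -rmorphD ltcR.
Qed.

End scalars.

(** * Inner product calculus and the Cauchy-Schwarz inequality *)

Section inner_product.
Context {K : numFieldType} {theta : K -> K} (HK : real_or_complex theta).
Context {H : hilbertType theta}.
Implicit Types x y z : H.

Lemma innerC x y : inner x y = theta (inner y x).
Proof. by rewrite (@hermitian_subproof _ _ _ _ (@inner K theta H)) expr0 mul1r. Qed.

Lemma innerBl x y z : inner (x - y) z = inner x z - inner y z.
Proof. exact: (@zmod_morphisml_subproof _ _ _ _ _ _ (@inner K theta H)). Qed.

Lemma innerBr x y z : inner x (y - z) = inner x y - inner x z.
Proof. exact: (@zmod_morphismr_subproof _ _ _ _ _ _ (@inner K theta H)). Qed.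

Lemma innerZl a x y : inner (a *: x) y = a * inner x y.
Proof. exact: (@linearl_subproof _ _ _ _ _ _ (@inner K theta H)). Qed.

Lemma innerZr a x y : inner x (a *: y) = theta a * inner x y.
Proof. exact: (@linearr_subproof _ _ _ _ _ _ (@inner K theta H)). Qed.

Lemma inner0l x : inner 0 x = 0.
Proof. by rewrite -(subrr 0) innerBl subrr. Qed.

Lemma inner0r x : inner x 0 = 0.
Proof. by rewrite -(subrr 0) innerBr subrr. Qed.

Lemma innerNl x y : inner (- x) y = - inner x y.
Proof. by rewrite -[- x]sub0r innerBl inner0l sub0r. Qed.

Lemma innerNr x y : inner x (- y) = - inner x y.
Proof. by rewrite -[- y]sub0r innerBr inner0r sub0r. Qed.

Lemma innerDl x y z : inner (x + y) z = inner x z + inner y z.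
Proof. by rewrite -{1}[y]opprK innerBl innerNl opprK. Qed.

Lemma innerDr x y z : inner x (y + z) = inner x y + inner x z.
Proof. by rewrite -{1}[z]opprK innerBr innerNr opprK. Qed.

Lemma inner_eq0 x : inner x x = 0 -> x = 0.
Proof. by rewrite inner_norm => /eqP; rewrite sqrf_eq0 normr_eq0 => /eqP. Qed.

(** The cross term is kept as a number plus its conjugate, which stands for twice the real part over
    both fields. *)
Lemma sqr_normDZ x y t : `|x + t *: y| ^+ 2 =
  `|x| ^+ 2 + (theta t * inner x y + theta (theta t * inner x y)) +
  `|t| ^+ 2 * `|y| ^+ 2.
Proof.
rewrite -!inner_norm !innerDl !innerDr !innerZl !innerZr (innerC y x).
rewrite (conjM HK) (conjK HK) -(normCK_conj HK); ring.
Qed.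

Lemma cauchy_schwarz x y : `|inner x y| <= `|x| * `|y|.
Proof.
have [->|y0] := eqVneq y 0; first by rewrite inner0r !normr0 mulr0.
have ny0 : 0 < `|y| by rewrite normr_gt0.
rewrite -(ler_pXn2r (n := 2)) ?nnegrE ?mulr_ge0// exprMn.
(* With this [a], the vector [x - (a * z) *: y] is the component of [x] orthogonal to [y]; its
   squared norm being nonnegative gives the bound. *)
set z := inner x y; pose a := `|y| ^- 2.
have a0 : 0 <= a by rewrite invr_ge0 exprn_ge0.
have ay : a * `|y| ^+ 2 = 1 by rewrite mulVf// expf_neq0// gt_eqF.
have az0 : 0 <= a * `|z| ^+ 2 by rewrite mulr_ge0// exprn_ge0.
have := exprn_ge0 2 (normr_ge0 (x + (- (a * z)) *: y)).
rewrite sqr_normDZ -/z normrN normrM (ger0_norm a0) (conjN HK) (conjM HK a).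
rewrite (conj_ge0_id HK a0).
have -> : - (a * theta z) * z = - (a * `|z| ^+ 2).
  by rewrite -(normCK_conj HK z); ring.
rewrite (conjN HK) (conj_ge0_id HK az0) => h.
rewrite -subr_ge0 -(pmulr_rge0 _ (_ : 0 < a)) ?invr_gt0 ?exprn_gt0//.
apply: le_trans h _; rewrite exprMn.
have -> : a ^+ 2 * `|z| ^+ 2 * `|y| ^+ 2 = a * `|z| ^+ 2.
  by rewrite -[RHS]mulr1 -ay; ring.
have -> : a * (`|x| ^+ 2 * `|y| ^+ 2 - `|z| ^+ 2) = `|x| ^+ 2 - a * `|z| ^+ 2.
  by rewrite mulrBr mulrCA ay mulr1.
by rewrite le_eqVlt; apply/orP; left; apply/eqP; ring.
Qed.

End inner_product.

(** * Linear isometries: inner products and continuity *)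

Section isometries.
Context {K : numFieldType} {theta : K -> K} (HK : real_or_complex theta).
Context {U V : hilbertType theta}.

Lemma isometry_inner (f : U -> V) x y :
  linear_isometry f -> inner (f x) (f y) = inner x y.
Proof.
move=> [flin fN]; set d := inner (f x) (f y) - inner x y.
suff /eqP : `|d| ^+ 2 = 0 by rewrite sqrf_eq0 normr_eq0 subr_eq0 => /eqP.
have flin' t : f (x + t *: y) = f x + t *: f y by rewrite addrC flin addrC.
(* Polarization with the defect [d] itself as scalar: the cross terms leave [2 * |d|^2 = 0], in one
   computation for both fields. *)
have := fN (x + d *: y); rewrite flin' => /(congr1 (fun s => s ^+ 2)).
rewrite !(sqr_normDZ HK) !fN => /addIr/addrI /eqP.
rewrite -subr_eq0 opprD addrACA -mulrBr -/d -(conjN HK) -(conjD HK) -mulrBr -/d.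
rewrite (mulrC (theta d)) (normCK_conj HK) (conj_ge0_id HK) ?exprn_ge0//.
by rewrite -mulr2n -mulr_natr mulf_eq0 pnatr_eq0/= orbF => /eqP.
Qed.

Lemma isometryB (f : U -> V) x y : linear_isometry f -> f (x - y) = f x - f y.
Proof.
by move=> [flin _]; rewrite addrC -scaleN1r flin scaleN1r addrC.
Qed.

Lemma isometryN (f : U -> V) x : linear_isometry f -> f (- x) = - f x.
Proof. by move=> fI; rewrite -[- x]sub0r -(subrr x) !isometryB// subrr sub0r. Qed.

Lemma isometry_continuous (f : U -> V) : linear_isometry f -> continuous f.
Proof.
move=> fI x; apply/cvgrPdist_lt => e e0; near=> y.
rewrite -isometryB// fI.2; near: y.
exact: (@cvgr_dist_lt _ _ _ _ _ id).
Unshelve. all: by end_near. Qed.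

End isometries.

(** * Limits of shrinking sets and metric forms of closedness *)

Section completeness.
Context {K : numFieldType}.

(** Positive scalars are real, hence comparable, even when the order of [K] is partial. *)
Lemma pos_min2 (d1 d2 : K) : 0 < d1 -> 0 < d2 ->
  exists2 d, 0 < d & d <= d1 /\ d <= d2.
Proof.
move=> d1_gt0 d2_gt0.
have [|/ltW] := real_leP (gtr0_real d1_gt0) (gtr0_real d2_gt0).
  by exists d1.
by exists d2.
Qed.

Lemma shrinking_proper_filter (T : Type) (E : K -> set T) :
  (forall d1 d2, d1 <= d2 -> E d1 `<=` E d2) ->
  (forall d, 0 < d -> E d !=set0) ->
  ProperFilter (filter_from [set d | 0 < d] E).
Proof.
move=> Emono E0; apply: filter_from_proper => //.
apply: filter_from_filter; first by exists 1 => /=.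
move=> d1 d2 d1_gt0 d2_gt0; have [d d0 [dd1 dd2]] := pos_min2 d1_gt0 d2_gt0.
by exists d => //= x Ex; split; [exact: Emono dd1 _ _|exact: Emono dd2 _ _].
Qed.

(** Cantor's argument: the sets generate a Cauchy filter. As they may fail to be closed, the limit
    is only said to be near them. *)
Lemma shrinking_limit (U : completeNormedModType K) (E : K -> set U) :
  (forall d1 d2, d1 <= d2 -> E d1 `<=` E d2) ->
  (forall d, 0 < d -> E d !=set0) ->
  (forall e, 0 < e -> exists2 d, 0 < d &
     forall x y, E d x -> E d y -> `|x - y| < e) ->
  exists l, forall e, 0 < e -> exists2 d, 0 < d &
    forall x, E d x -> `|l - x| < e.
Proof.
move=> Emono E0 Ediam; pose F := filter_from [set d | 0 < d] E.
have FF : ProperFilter F by exact: shrinking_proper_filter.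
have Fc : cvg F.
  apply: cauchy_cvg; apply: cauchy_exP => e /Ediam[d d0 dE].
  have [x Ex] := E0 d d0; exists x; exists d => //= y Ey.
  by rewrite -ball_normE/=; exact: dE.
exists (lim F) => e e0.
have e20 : 0 < e / 2 by rewrite divr_gt0.
have [d d0 dE] := Ediam _ e20; exists d => // x Ex.
have /filter_ex[y [Ey yl]] : F (E d `&` ball (lim F) (e / 2)).
  by apply: filterI; [exists d|exact/Fc/nbhsx_ballx].
move: yl; rewrite -ball_normE/= => yl.
rewrite -(subrKA y) (le_lt_trans (ler_normD _ _))// [ltRHS]splitr.
by rewrite ltrD// dE.
Qed.

Lemma closed_pairP (U V : normedModType K) (G : set (U * V)) :
  closed G <-> forall a b, (forall e, 0 < e ->
    exists c, G c /\ `|a - c.1| < e /\ `|b - c.2| < e) -> G (a, b).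
Proof.
split=> [Gcl a b h|h [a b] /= clab].
  apply: Gcl => B /nbhs_ballP[e /= e0 eB].
  have [c [Gc [ac bc]]] := h e e0; exists c; split=> //; apply: eB.
  by split; rewrite -ball_normE.
apply: h => e e0; have [|c [Gc]] := clab (ball (a, b) e).
  exact: nbhsx_ballx.
by case; rewrite -!ball_normE/= => ac bc; exists c.
Qed.

Lemma closureNP (U : normedModType K) (G : set U) a :
  closure G a <-> forall e, 0 < e -> exists2 c, G c & `|a - c| < e.
Proof.
split=> [cla e e0|h B /nbhs_ballP[e /= e0 eB]].
  have [c [Gc]] := cla (ball a e) (nbhsx_ballx _ _ e0).
  by rewrite -ball_normE/=; exists c.
by have [c Gc ac] := h e e0; exists c; split=> //; apply: eB; rewrite -ball_normE.
Qed.

Definition linear_subspace (E : lmodType K) (M : set E) : Prop :=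
  M 0 /\ forall (a : K) x y, M x -> M y -> M (a *: x + y).

Lemma linear_subspaceB (E : lmodType K) (M : set E) x y :
  linear_subspace M -> M x -> M y -> M (x - y).
Proof. by move=> [_ Mlin] Mx My; rewrite addrC -scaleN1r; exact: Mlin. Qed.

Lemma le_eps_le0 (c x : K) : 0 <= c ->
  (forall e, 0 < e -> x <= e * c) -> x <= 0.
Proof.
move=> c0 h; apply/ler_addgt0Pr => e e0; rewrite add0r.
(* The shift by 1 guards the division against [c = 0]. *)
have c1 : 0 < c + 1 by rewrite ltr_wpDl.
apply: le_trans (h (e / (c + 1)) _) _; first exact: divr_gt0.
by rewrite -mulrA ler_piMr ?(ltW e0)// mulrC ler_pdivrMr// mul1r lerDl.
Qed.

End completeness.

(** * Orthogonal projection in the Hilbert sum of two spaces *)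

Section projection.
Context {K : numFieldType} {theta : K -> K} (HK : real_or_complex theta).
Context {U V : hilbertType theta}.

(** The type [U * V] carries the maximum norm, so the squared distance of the Hilbert sum is written
    by components. *)
Let sqdist (p : U) (q : V) (c : U * V) := `|p - c.1| ^+ 2 + `|q - c.2| ^+ 2.

Lemma parallelogram (H : hilbertType theta) (x y : H) :
  `|x - y| ^+ 2 + `|x + y| ^+ 2 = 2 * `|x| ^+ 2 + 2 * `|y| ^+ 2.
Proof.
rewrite -!inner_norm !(innerBl, innerDl, innerBr, innerDr); ring.
Qed.

(** The parallelogram law in each component. A midpoint is no closer than the infimum, so
    near-minimisers are close together. *)
Lemma sqdist_midpoint p q c c' :
  `|c.1 - c'.1| ^+ 2 + `|c.2 - c'.2| ^+ 2 =
  2 * sqdist p q c + 2 * sqdist p q c' -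
  4 * sqdist p q (2^-1 *: (c + c')).
Proof.
have mid (H : hilbertType theta) (o x y : H) :
    4 * `|o - 2^-1 *: (x + y)| ^+ 2 = `|(o - y) + (o - x)| ^+ 2.
  have -> : (o - y) + (o - x) = 2 *: (o - 2^-1 *: (x + y)).
    rewrite scalerBr scalerA mulfV ?pnatr_eq0// scale1r scaler_nat mulr2n.
    by rewrite addrACA -opprD (addrC y).
  by rewrite normrZ exprMn ger0_norm// -natrX.
have diff (H : hilbertType theta) (o x y : H) : `|x - y| = `|(o - y) - (o - x)|.
  by rewrite opprB [in RHS]addrC addrA subrK.
rewrite /sqdist -[(_ *: _).1]/(2^-1 *: (c.1 + c'.1)).
rewrite -[(_ *: _).2]/(2^-1 *: (c.2 + c'.2)).
rewrite (mulrDr 4) !mid (diff _ p c.1) (diff _ q c.2).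
have := parallelogram (p - c'.1) (p - c.1).
have := parallelogram (q - c'.2) (q - c.2).
by move=> /(canRL (addrK _)) -> /(canRL (addrK _)) ->; ring.
Qed.

(** The projection is the limit of the sets [E e] of points of [G] whose squared distance is within
    [e] of the infimum; near-minimality forces near-orthogonality, exact in the limit. *)
Lemma orthogonal_projection (G : set (U * V)) p q :
  linear_subspace G -> closed G -> exists2 g, G g &
    forall c, G c -> inner c.1 (p - g.1) + inner c.2 (q - g.2) = 0.
Proof.
move=> Gsub Gcl; have [G0 Glin] := Gsub.
pose N := sqdist p q.
have [|_ [c Gc <-]|d dmin dinf] := @nonneg_inf K theta HK (N @` G).
- by exists (N 0); exists 0.
- by rewrite addr_ge0// exprn_ge0.
pose E e := G `&` [set c | N c <= d + e].
have E0 (e : K) : 0 < e -> E e !=set0.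
  by move=> /dinf[_ [c Gc <-] /ltW]; exists c.
have Emono e1 e2 : e1 <= e2 -> E e1 `<=` E e2.
  by move=> e12 c [Gc Nc]; split=> //=; rewrite (le_trans Nc)// lerD2l.
have Ediam e c c' : E e c -> E e c' ->
    `|c.1 - c'.1| ^+ 2 + `|c.2 - c'.2| ^+ 2 <= 4 * e.
  move=> [Gc Nc] [Gc' Nc']; rewrite (sqdist_midpoint p q) -/N.
  have Nm : d <= N (2^-1 *: (c + c')).
    apply: dmin; exists (2^-1 *: (c + c')) => //; rewrite scalerDr.
    by apply: (Glin) => //; rewrite -[_ *: c']addr0; exact: Glin.
  have -> : 4 * e = 2 * (d + e) + 2 * (d + e) - 4 * d by ring.
  by rewrite lerB ?ler_pM2l// lerD// ler_pM2l.
(* [Ediam] at tolerance [(e / 3) ^+ 2] leaves the factor 4/9, hence a strict inequality. *)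
have sqlt (e : K) : 0 < e -> 4 * (e / 3) ^+ 2 < e ^+ 2.
  move=> e0; rewrite exprMn mulrCA -subr_gt0.
  have -> : e ^+ 2 - e ^+ 2 * (4 * 3^-1 ^+ 2) = e ^+ 2 * (5 / 9) by field.
  by rewrite mulr_gt0 ?exprn_gt0 ?divr_gt0.
have [a aE] : exists a, forall e, 0 < e -> exists2 d, 0 < d &
    forall x, (fst @` E d) x -> `|a - x| < e.
  apply: shrinking_limit => [e1 e2 /Emono e12|e /E0[c Ec]|e e0].
  - exact: image_subset.
  - by exists c.1; exists c.
  exists ((e / 3) ^+ 2); first by rewrite exprn_gt0 ?divr_gt0.
  move=> _ _ [c Ec <-] [c' Ec' <-].
  rewrite -(ltr_pXn2r (n := 2)) ?nnegrE ?(ltW e0)//.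
  apply: le_lt_trans (sqlt e e0).
  by apply: le_trans (Ediam _ _ _ Ec Ec'); rewrite lerDl exprn_ge0.
have [b bE] : exists b, forall e, 0 < e -> exists2 d, 0 < d &
    forall x, (snd @` E d) x -> `|b - x| < e.
  apply: shrinking_limit => [e1 e2 /Emono e12|e /E0[c Ec]|e e0].
  - exact: image_subset.
  - by exists c.2; exists c.
  exists ((e / 3) ^+ 2); first by rewrite exprn_gt0 ?divr_gt0.
  move=> _ _ [c Ec <-] [c' Ec' <-].
  rewrite -(ltr_pXn2r (n := 2)) ?nnegrE ?(ltW e0)//.
  apply: le_lt_trans (sqlt e e0).
  by apply: le_trans (Ediam _ _ _ Ec Ec'); rewrite lerDr exprn_ge0.
(* [a] and [b] are limits of the two projections of [E] taken separately; a common tolerance gives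
   one [g] near both. *)
have approx (e d0 : K) : 0 < e -> 0 < d0 ->
    exists2 g, E d0 g & `|a - g.1| < e /\ `|b - g.2| < e.
  move=> e0 d0_gt0; have [d1 d1_gt0 aE1] := aE e e0.
  have [d2 d2_gt0 bE2] := bE e e0.
  have [d3 d3_gt0 [d31 d32]] := pos_min2 d1_gt0 d2_gt0.
  have [d4 d4_gt0 [d43 d40]] := pos_min2 d3_gt0 d0_gt0.
  have [g Eg] := E0 d4 d4_gt0; exists g; first exact: Emono Eg.
  split; [apply: aE1|apply: bE2]; exists g => //; apply: Emono Eg.
    exact: le_trans d31.
  exact: le_trans d32.
exists (a, b).
  move/closed_pairP : Gcl; apply=> e e0.
  by have [g [Gg _] ?] := approx e 1 e0 ltr01; exists g.
move=> h Gh /=; set Nh := `|h.1| ^+ 2 + `|h.2| ^+ 2.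
have Nh0 : 0 <= Nh by rewrite addr_ge0// exprn_ge0.
have Nh1 : 0 < Nh + 1 by rewrite ltr_wpDl.
(* Compare the distances to [g] and to [g + (a' * w) *: h], where [w] is the
   conjugate of the sum below and [a'] is a near-optimal step. *)
have almost (e : K) g : 0 < e -> E (e ^+ 2) g ->
    `|inner h.1 (p - g.1) + inner h.2 (q - g.2)| <= e * (Nh + 1).
  move=> e0 [Gg /= Ng]; set z := _ + _.
  pose a' := (Nh + 1)^-1; have a'0 : 0 < a' by rewrite invr_gt0.
  pose w := inner (p - g.1) h.1 + inner (q - g.2) h.2.
  have -> : `|z| = `|w|.
    by rewrite /w (innerC _ h.1) (innerC _ h.2) -(conjD HK) (norm_conj HK).
  have Gs : G (g - (- (a' * w)) *: h).
    by rewrite -scaleNr addrC; exact: Glin.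
  have aw0 : 0 <= a' * `|w| ^+ 2 by rewrite mulr_ge0 ?exprn_ge0// ltW.
  have cross : theta (- (a' * w)) * w = - (a' * `|w| ^+ 2).
    rewrite (conjN HK) (conjM HK) (conj_ge0_id HK (ltW a'0)).
    by rewrite -(normCK_conj HK); ring.
  have : d <= N g - 2 * (a' * `|w| ^+ 2) + a' ^+ 2 * `|w| ^+ 2 * Nh.
    apply: le_trans (dmin _ (ex_intro2 _ _ _ Gs erefl)) _.
    rewrite /N /sqdist /= !opprD !opprK !addrA !(sqr_normDZ HK).
    rewrite le_eqVlt; apply/orP; left; apply/eqP.
    rewrite normrN normrM (ger0_norm (ltW a'0)).
    transitivity (N g + (theta (- (a' * w)) * w + theta (theta (- (a' * w)) * w)) +
      (a' * `|w|) ^+ 2 * Nh); last first.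
      rewrite cross (conjN HK) (conj_ge0_id HK aw0) /N /sqdist; ring.
    set t := theta (- _); set n := `|w|.
    by rewrite /w /N /sqdist /Nh mulrDr (conjD HK); ring.
  have -> : a' ^+ 2 * `|w| ^+ 2 * Nh = a' * `|w| ^+ 2 * (a' * Nh) by ring.
  move=> dle; have : a' * `|w| ^+ 2 <= e ^+ 2.
    have an1 : a' * Nh <= 1 by rewrite ler_pdivrMl// mulr1 lerDl.
    move: (lerD dle Ng) (ler_wpM2l aw0 an1); set ww := a' * _.
    rewrite mulr1 => h1 h2.
    have := lerD h1 h2; rewrite -subr_ge0 => h3; rewrite -subr_ge0.
    by apply: le_trans h3 _; rewrite le_eqVlt; apply/orP; left; apply/eqP; ring.
  rewrite ler_pdivrMl// => we.
  rewrite -(ler_pXn2r (n := 2)) ?nnegrE ?mulr_ge0 ?(ltW e0) ?(ltW Nh1)//.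
  apply: le_trans we _; rewrite exprMn mulrC ler_pM2l ?exprn_gt0//.
  by rewrite expr2 ler_peMr ?lerDr// ltW.
apply/eqP; rewrite -normr_le0.
(* [Nh + 1] comes from [almost]; [|h.1|] and [|h.2|] come from Cauchy-Schwarz when [(a, b)] replaces
   [g]. *)
apply: (@le_eps_le0 _ (Nh + 1 + `|h.1| + `|h.2|)).
  by rewrite !addr_ge0// ltW.
move=> e e0; have [g Eg [ag bg]] := approx e (e ^+ 2) e0 (exprn_gt0 2 e0).
have -> : inner h.1 (p - a) + inner h.2 (q - b) =
    (inner h.1 (p - g.1) + inner h.2 (q - g.2)) -
    inner h.1 (a - g.1) - inner h.2 (b - g.2).
  by rewrite !innerBr; ring.
rewrite (mulrDr e _ `|h.2|) (mulrDr e _ `|h.1|).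
apply: le_trans (ler_normB _ _) (lerD (le_trans (ler_normB _ _) (lerD _ _)) _).
- exact: almost Eg.
- by rewrite (le_trans (cauchy_schwarz HK _ _))// mulrC ler_wpM2r// ltW.
- by rewrite (le_trans (cauchy_schwarz HK _ _))// mulrC ler_wpM2r// ltW.
Qed.
End projection.

(** * Graphs and kernels of partially defined linear operators *)

Section linear_operators.
Context {K : numFieldType} {U V : completeNormedModType K}.
Context (T : operator U V) (Tlin : op_linear T).

Lemma op0 : T 0 = 0.
Proof.
have [T0 Tl] := Tlin; have [_] := Tl 1 0 0 T0 T0.
by rewrite !scale1r addr0 => /eqP; rewrite -subr_eq0 opprD addNKr oppr_eq0 => /eqP.
Qed.

Lemma opZ a x : op_dom T x -> op_dom T (a *: x) /\ T (a *: x) = a *: T x.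
Proof.
move=> Tx; have [T0 Tl] := Tlin; have := Tl a x 0 Tx T0.
by rewrite op0 !addr0.
Qed.

Lemma opB x y : op_dom T x -> op_dom T y ->
  op_dom T (x - y) /\ T (x - y) = T x - T y.
Proof.
move=> Tx Ty; have [_ Tl] := Tlin; have := Tl (- 1) y x Ty Tx.
by rewrite !scaleN1r ![- _ + _]addrC.
Qed.

Lemma op_graph_subspace : linear_subspace (op_graph T).
Proof.
have [T0 Tl] := Tlin; split; first by split => //=; exact: op0.
move=> a [x x'] [y y'] [/= Tx <-] [/= Ty <-].
exact: Tl.
Qed.

Lemma op_ker_subspace : linear_subspace (op_ker T).
Proof.
have [T0 Tl] := Tlin; split; first by split => //; exact: op0.
move=> a x y [Tx Tx0] [Ty Ty0]; have [Txy TxyE] := Tl a x y Tx Ty.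
by split=> //; rewrite TxyE Tx0 Ty0 scaler0 addr0.
Qed.

Lemma op_ker_closed : closed (op_graph T) -> closed (op_ker T).
Proof.
move=> /closed_pairP Tcl x /closureNP clx; apply: (Tcl x 0) => e e0.
have [c [Tc Tc0] xc] := clx e e0; exists (c, 0).
by split=> //=; rewrite subr0 normr0.
Qed.

End linear_operators.

(** * Orthogonal complements, adjoints and reduced operators *)

Section hilbert_operators.
Context {K : numFieldType} {theta : K -> K} (HK : real_or_complex theta).

Lemma inner_orthC (H : hilbertType theta) (x y : H) :
  inner x y = 0 -> inner y x = 0.
Proof. by move=> xy; rewrite innerC xy (conj_ge0_id HK). Qed.

Lemma orthocompl_subspace (H : hilbertType theta) (S : set H) :
  linear_subspace (orthocompl S).
Proof.
split=> [y _|a x y Sx Sy z Sz]; first by rewrite inner0l.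
by rewrite innerDl innerZl Sx// Sy// mulr0 addr0.
Qed.

Lemma orthocompl_closed (H : hilbertType theta) (S : set H) :
  closed (orthocompl S).
Proof.
move=> x /closureNP clx y Sy; apply/eqP; rewrite -normr_le0.
apply: (@le_eps_le0 _ `|y|) => // e /clx[c Sc xc].
rewrite -[x](subrK c) innerDl Sc// addr0.
by apply: le_trans (cauchy_schwarz HK _ _) _; rewrite ler_wpM2r// ltW.
Qed.

(** [inner z z = inner z (z - c)] for [c] in [S], and density makes [z - c] arbitrarily small. *)
Lemma orthocompl_dense (H : hilbertType theta) (S : set H) z :
  dense S -> orthocompl S z -> z = 0.
Proof.
move=> Sd Sz; apply: inner_eq0; apply/eqP; rewrite -normr_le0.
apply: (@le_eps_le0 _ `|z|) => // e e0.
have [|c []] := Sd (ball z e) _ (ball_open _ _).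
  by exists z; exact: ballxx.
rewrite -ball_normE/= => zc Sc.
have -> : inner z z = inner z (z - c) by rewrite innerBr (Sz c Sc) subr0.
by apply: le_trans (cauchy_schwarz HK _ _) _; rewrite mulrC ler_wpM2r// ltW.
Qed.

(* Projecting [(0, v)] on the graph of [f] restricted to [M] gives half of
   the vector sought. *)
Lemma isometry_adjoint (U V : hilbertType theta) (f : U -> V) (M : set U) v :
  linear_isometry f -> linear_subspace M -> closed M ->
  exists2 m, M m & forall c, M c -> inner c m = inner (f c) v.
Proof.
move=> fI [M0 Mlin] Mcl; have [flin fN] := fI.
pose G := [set c : U * V | M c.1 /\ f c.1 = c.2].
have Gsub : linear_subspace G.
  split; first by split=> //=; rewrite -(subrr 0) isometryB// subrr.
  move=> a [x x'] [y y'] [/= Mx <-] [/= My <-].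
  by split; [exact: Mlin|exact: flin].
have Gcl : closed G.
  apply/closed_pairP => a b h; split => /=.
    by apply: Mcl; apply/closureNP => e /h[c [[Mc _] [ac _]]]; exists c.1.
  apply/eqP; rewrite -subr_eq0 -normr_le0; apply: (@le_eps_le0 _ 2) => // e.
  move=> /h[[c c'] [[/= Mc <-] [ac bc]]].
  rewrite -(subrKA (f c)) mulr_natr mulr2n; apply: le_trans (ler_normD _ _) _.
  by rewrite -isometryB// fN lerD// ltW// distrC.
have [[a b] [/= Ma <-] orth] := orthogonal_projection HK 0 v Gsub Gcl.
exists (2 *: a) => [|c Mc]; first by rewrite -[_ *: a]addr0; exact: Mlin.
have := orth (c, f c) (conj Mc erefl).
rewrite /= sub0r innerNr innerBr (isometry_inner HK)// innerZr (conj_ge0_id HK)//.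
move=> /eqP; rewrite addrCA -opprD subr_eq0 => /eqP ->; ring.
Qed.

Lemma adjointP (U V : hilbertType theta) (T : operator U V) y :
  op_dom (adjoint T) y -> adjoint_pair T y (adjoint T y).
Proof. by move=> /xgetPex; exact. Qed.

Lemma adjoint_unique (U V : hilbertType theta) (T : operator U V) y z :
  dense (op_dom T) -> adjoint_pair T y z -> adjoint T y = z.
Proof.
move=> Td Tyz; apply/eqP; rewrite -subr_eq0; apply/eqP.
apply: (orthocompl_dense Td) => x Tx.
apply: inner_orthC; rewrite innerBr -Tyz// -adjointP// ?subrr//.
by exists z.
Qed.

(** Project [(x, y)] on the graph of [T]. Orthogonality of the residual to the graph says that
    [y - T a] lies in the domain of the adjoint, with value [-(x - a)]. The hypothesis at [y - T a]
    makes the residual orthogonal to [(x, y)] too, hence to itself. *)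
Lemma double_adjoint (U V : hilbertType theta) (T : operator U V) x y :
  densely_defined_closed_linear T ->
  (forall w, op_dom (adjoint T) w -> inner x (adjoint T w) = inner y w) ->
  op_dom T x /\ T x = y.
Proof.
move=> [Tlin Td Tcl] h.
have [[a b] [/= Ta <-] orth] :=
  orthogonal_projection HK x y (op_graph_subspace Tlin) Tcl.
have pair : adjoint_pair T (y - T a) (- (x - a)).
  move=> c Tc; rewrite innerNr; apply/eqP; rewrite -addr_eq0 addrC.
  by apply/eqP; exact: (orth (c, T c) (conj Tc erefl)).
have := h (y - T a) (ex_intro _ _ pair).
rewrite (adjoint_unique Td pair) innerNr => /eqP.
rewrite -subr_eq0 -opprD oppr_eq0 => /eqP e1.
have := orth (a, T a) (conj Ta erefl); rewrite /= => e2.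
have : inner (x - a) (x - a) + inner (y - T a) (y - T a) = 0.
  rewrite (innerBl x) (innerBl y) addrACA -opprD e1 e2; ring.
rewrite !inner_norm => /eqP; rewrite paddr_eq0 ?exprn_ge0// !sqrf_eq0 !normr_eq0.
by rewrite !subr_eq0 => /andP[/eqP -> /eqP ->].
Qed.

(** Subtract from [u] its projection on the kernel, which is [isometry_adjoint] for the identity
    map. *)
Lemma reduced_preimage (U V : hilbertType theta) (T : operator U V) u :
  densely_defined_closed_linear T -> op_dom T u ->
  exists2 u', op_dom (reduced T) u' & T u' = T u.
Proof.
move=> [Tlin Td Tcl] Tu.
have idI : linear_isometry (@idfun U) by split.
have [m [Tm Tm0] mP] := isometry_adjoint u idI (op_ker_subspace Tlin)
  (op_ker_closed Tcl).
have [Tum TumE] := opB Tlin Tu Tm; exists (u - m); last by rewrite TumE Tm0 subr0.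
split=> // c /mP/= cm; apply: inner_orthC.
by rewrite innerBr cm subrr.
Qed.

(* Unit vectors violating every bound would cluster, by compactness, at a unit
   vector of the kernel orthogonal to the kernel. *)
Lemma reduced_bounded_below (U V : hilbertType theta) (T : operator U V) :
  densely_defined_closed_linear T -> compact_dom_embedding (reduced T) ->
  exists2 C : K, 0 <= C & forall u, op_dom (reduced T) u -> `|u| <= C * `|T u|.
Proof.
move=> [Tlin Td Tcl] Tcpt; apply: contrapT => nC.
pose E e := op_dom (reduced T) `&` [set u | `|u| = 1 /\ `|T u| <= e].
have E0 (e : K) : 0 < e -> E e !=set0.
  move=> e0; apply: contrapT => nE; apply: nC; exists e^-1.
    by rewrite invr_ge0 ltW.
  move=> u [Tu uker]; rewrite ler_pdivlMl//.
  have [->|u0] := eqVneq u 0; first by rewrite normr0 mulr0.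
  have nu0 : 0 < `|u| by rewrite normr_gt0.
  have [|/ltW//] := real_leP (normr_real (T u))
    (realM (gtr0_real e0) (normr_real u)).
  (* If the bound with constant [e^-1] fails at [u], normalising [u] gives a member of [E e]. *)
  move=> Tue; exfalso; apply: nE; exists (`|u|^-1 *: u).
  have [Tu' Tu'E] := opZ Tlin (`|u|^-1) Tu; split.
    split=> // c kc; by rewrite innerZl uker// mulr0.
  rewrite /= Tu'E !normrZ ger0_norm ?invr_ge0// mulVf ?gt_eqF//; split=> //.
  by rewrite ler_pdivrMl// mulrC.
have Emono (e1 e2 : K) : e1 <= e2 -> E e1 `<=` E e2.
  by move=> e12 u [Tu [u1 Tue]]; split=> //; split=> //; exact: le_trans e12.
have cptE : compact (closure (E 1)).
  rewrite -precompactE; apply: Tcpt; split; first by move=> u [].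
  exists 2 => // u [_ [-> Tu1]]; apply: (@le_trans _ _ (1 + 1)).
    by rewrite expr1n lerD2l exprn_ile1.
  by rewrite -natrX -[leLHS]/(2%:R) ler_nat.
have [|p [_ pF]] := cptE _ (shrinking_proper_filter Emono E0).
  by exists 1 => //=; exact: subset_closure.
have pE (e : K) : 0 < e -> exists2 u, E e u & `|p - u| < e.
  move=> e0; have [u [Eu]] := pF (E e) (ball p e) (ex_intro2 _ _ e e0 (fun _ => id))
    (nbhsx_ballx _ _ e0).
  by rewrite -ball_normE/=; exists u.
have kp : op_ker T p.
  move/closed_pairP : Tcl; apply=> e e0.
  have e20 : 0 < e / 2 by rewrite divr_gt0.
  have [u [[Tu _] [_ Tue]] pu] := pE _ e20.
  have e2e : e / 2 < e by rewrite ltr_pdivrMr// mulr_natr mulr2n ltrDl.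
  exists (u, T u); split=> //=; rewrite sub0r normrN.
  by split; [exact: lt_trans e2e|exact: le_lt_trans e2e].
(* [u] is a unit vector orthogonal to [p], so [inner u (u - p)] is 1, while Cauchy-Schwarz makes it
   smaller. *)
have [u [[_ uker] [u1 _]] pu] := pE 1 ltr01.
have : `|inner u (u - p)| < 1.
  apply: le_lt_trans (cauchy_schwarz HK _ _) _.
  by rewrite u1 mul1r distrC.
by rewrite innerBr (uker p kp) subr0 inner_norm u1 expr1n normr1 ltxx.
Qed.

End hilbert_operators.

(** * Transfer along the isometries *)

Section transfer.
Context {K : numFieldType} {theta : K -> K} (HK : real_or_complex theta).
Context {H0 H1 X Y : hilbertType theta}.
Context (A0 A : operator H0 H1) (calA : operator X Y).
Context (iX : H0 -> X) (iY : H1 -> Y).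
Hypotheses (iXI : linear_isometry iX) (iYI : linear_isometry iY).
Hypothesis Hadj : op_total iX \oop op_opp (adjoint A) `<=op`
  op_opp (adjoint calA) \oop op_total iY.

Lemma adjoint_lift w : op_dom (adjoint A) w ->
  op_dom (adjoint calA) (iY w) /\ adjoint calA (iY w) = iX (adjoint A w).
Proof.
move=> Aw; have [/(_ w)[//|_ /= Aw'] /(_ w (conj Aw I))/= E] := Hadj; split=> //.
by rewrite -[LHS]opprK -E (isometryN _ iXI) opprK.
Qed.

(** [x] is the adjoint of [iX] at [u]. For [w] in the domain of [adjoint A], pairing [x] with
    [adjoint A w] is pairing [u] with [adjoint calA (iY w)], thus [iY y] with [iY w], thus [y] with
    [w]; [double_adjoint] concludes. *)
Lemma pull_back u x y : densely_defined_closed_linear A ->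
  op_dom calA u -> calA u = iY y ->
  (forall c, inner c x = inner (iX c) u) -> op_dom A x /\ A x = y.
Proof.
move=> HA calAu uy xP; apply: (double_adjoint HK HA) => w Aw.
have [calAw AwE] := adjoint_lift Aw.
rewrite innerC xP -innerC -AwE -(adjointP calAw)// uy.
exact: isometry_inner.
Qed.

(** The preimage of [op_ran calA] under the continuous [iY] is closed and contains [op_ran A0]. *)
Lemma lift_closure_ran y :
  op_total iY \oop A0 `<=op` calA \oop op_total iX -> closed (op_ran calA) ->
  closure (op_ran A0) y -> exists2 u, op_dom calA u & calA u = iY y.
Proof.
move=> [A0dom A0E] ranA cly.
have iYcl : closed (iY @^-1` op_ran calA).
  by apply: preimage_closed => // x _; exact: isometry_continuous.
suff : (iY @^-1` op_ran calA) y by move=> [u Au uE]; exists u.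
apply: iYcl; apply: closureS cly => _ [x A0x <-] /=; exists (iX x).
  by have [] := A0dom x (conj A0x I).
exact: esym (A0E x (conj A0x I)).
Qed.

End transfer.

(** * Closed range and compactness for [sharp A0 A] *)

Theorem proposition4p3 (K : numFieldType) (theta : K -> K)
    (HK : real_or_complex theta)
    (H0 H1 X Y : hilbertType theta)
    (A0 A : operator H0 H1) (calA : operator X Y)
    (HA0 : densely_defined_closed_linear A0)
    (HA : densely_defined_closed_linear A)
    (HA0A : A0 `<=op` A)
    (HcalA : densely_defined_closed_linear calA)
    (Hran : closed (op_ran calA))
    (Hiota : let B0 := op_opp (adjoint A) in
       exists (iX : H0 -> X) (iY : H1 -> Y),
       [/\ linear_isometry iX, linear_isometry iY,
           op_total iY \oop A0 `<=op` calA \oop op_total iX &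
           op_total iX \oop B0 `<=op` op_opp (adjoint calA) \oop op_total iY]) :
  closed (op_ran (sharp A0 A)) /\
  (compact_dom_embedding (reduced calA) ->
   compact_dom_embedding (reduced (sharp A0 A))).
Proof.
have [iX [iY [iXI iYI HA0calA Hadj]]] := Hiota.
have [A0lin _ _] := HA0; have [Alin _ _] := HA.
(* With the whole space as subspace, [isometry_adjoint] is the full adjoint of [iX]. *)
have pre u : exists x, forall c, inner c x = inner (iX c) u.
  have [|x _ xP] := isometry_adjoint HK u iXI (_ : linear_subspace setT) closedT.
    by split.
  by exists x => c; exact: xP.
split.
  move=> y cly.
  have {}cly : closure (op_ran A0) y.
    apply: (@closed_closure _ (op_ran A0)); apply: closureS cly.
    by move=> _ [x [_ Ax] <-].
  have [u calAu uy] := lift_closure_ran iYI HA0calA Hran cly.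
  have [x xP] := pre u.
  have [Ax xy] := pull_back HK iXI iYI Hadj HA calAu uy xP.
  by exists x => //; split=> //=; rewrite xy.
move=> Hcpt S [Sdom [r r0 Sr]].
have [C C0 Cbnd] := reduced_bounded_below HK HcalA Hcpt.
pose M := orthocompl (op_ker (sharp A0 A)).
(* The lifts orthogonal to [op_ker calA] of the images of [S]. *)
pose W := op_dom (reduced calA) `&`
  [set u | exists2 x, S x & calA u = iY (A x)].
have Wcpt : compact (closure W).
  rewrite -precompactE; apply: Hcpt; split; first by move=> u [].
  (* From [|u| <= C * |A x|] and [|calA u| = |A x|], using [C^2 + 1 <= (C + 1)^2]. *)
  exists ((C + 1) * r) => [|u [Wu [x Sx ux]]]; first by rewrite mulr_ge0// addr_ge0.
  have xr : `|A x| ^+ 2 <= r ^+ 2.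
    by apply: le_trans (Sr _ Sx); rewrite lerDr exprn_ge0.
  have uA : `|calA u| = `|A x| by rewrite ux iYI.2.
  apply: (@le_trans _ _ ((C + 1) ^+ 2 * `|A x| ^+ 2)); last first.
    by rewrite exprMn ler_wpM2l// exprn_ge0// addr_ge0.
  have Cu : `|u| ^+ 2 <= C ^+ 2 * `|A x| ^+ 2.
    by rewrite -exprMn -uA lerXn2r ?nnegrE ?mulr_ge0//; exact: Cbnd.
  rewrite /= uA; apply: le_trans (lerD Cu (lexx _)) _.
  rewrite -[X in _ + X <= _]mul1r -mulrDl ler_wpM2r ?exprn_ge0//.
  by rewrite sqrrD1 lerD2r lerDl mulrn_wge0.
have Msub : linear_subspace M by exact: orthocompl_subspace.
have Mcl : closed M by exact: orthocompl_closed.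
have [f fP] : {f : X -> H0 & forall u, M (f u) /\
    forall c, M c -> inner c (f u) = inner (iX c) u}.
  apply: (@choice _ _ (fun u x =>
    M x /\ forall c, M c -> inner c x = inner (iX c) u)).
  by move=> u; have [x] := isometry_adjoint HK u iXI Msub Mcl; exists x.
have flip u v : `|f u - f v| <= `|u - v|.
  have Mf : M (f u - f v) by apply: linear_subspaceB Msub _ _; apply fP.
  have [->|n0] := eqVneq (f u - f v) 0; first by rewrite normr0.
  rewrite -(ler_pM2l (_ : 0 < `|f u - f v|)) ?normr_gt0// -expr2.
  (* The defining property of [f] is tested on [f u - f v], itself in [M]. *)
  have -> : `|f u - f v| ^+ 2 = `|inner (iX (f u - f v)) (u - v)|.
    rewrite innerBr -!(proj2 (fP _))// -innerBr inner_norm.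
    by rewrite [RHS]normrX normr_id.
  by apply: le_trans (cauchy_schwarz HK _ _) _; rewrite iXI.2.
have fcont : continuous f.
  move=> u; apply/cvgrPdist_lt => e e0; near=> v.
  apply: le_lt_trans (flip u v) _; near: v.
  exact: (@cvgr_dist_lt _ _ _ _ _ id).
apply: (@precompact_subset _ _ (f @` closure W)); last first.
  apply: compact_precompact; first exact: norm_hausdorff.
  by apply: continuous_compact => //; exact: continuous_subspaceT.
move=> x Sx; have [[Ax clAx] Mx] := Sdom x Sx.
(* Lift [A x], then move the lift into the reduced domain without changing its image. *)
have [u0 calAu0 u0x] := lift_closure_ran iYI HA0calA Hran clAx.
have [u Wu ux] := reduced_preimage HK HcalA calAu0.
exists u; first by apply: subset_closure; split=> //; exists x => //; rewrite ux.
have [x' x'P] := pre u; have [calAu _] := Wu.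
have [Ax' x'x] := pull_back HK iXI iYI Hadj HA calAu (etrans ux u0x) x'P.
have [AB ABE] := opB Alin Ax' Ax.
(* Both [x'] and [x] are mapped to [A x]; as 0 lies in [op_ran A0], the difference is in the domain
   of [sharp A0 A]. *)
have kerx : op_ker (sharp A0 A) (x' - x).
  have AB0 : A (x' - x) = 0 by rewrite ABE x'x subrr.
  split=> //; split=> //=; rewrite AB0; apply: subset_closure.
  by exists 0; [exact: A0lin.1|exact: op0].
have [Mfu fuP] := fP u; apply/eqP; rewrite -subr_eq0; apply/eqP.
(* For [c = f u - x] in [M], [inner c (f u) = inner c x'], so [inner c c = inner c (x' - x)], which
   vanishes since [x' - x] is in the kernel. *)
have Mc : M (f u - x) := linear_subspaceB Msub Mfu Mx.
apply: inner_eq0; rewrite innerBr fuP// -x'P -innerBr.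
exact: Mc.
Unshelve. all: by end_near. Qed.
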